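(* Let $\mathfrak r\subseteq N^3$ be a ternary relation on a finite ground set $N$. Then $\mathfrak r$ is fork representable if and only if $\mathfrak r$ is a regular forkness and its quotient is solvable.
   Context: Conjunctive forks. In a probability space $(\Omega,\mathcal F,P)$, an ordered triple $(A,B,C)$ of events is a conjunctive fork, written $(A,B,C)_P$, if $0<P(B)<1$ and, with $AC:=A\cap C$ and $\overline B:=\Omega\setminus B$: $P(AC|B)=P(A|B)P(C|B)$, $P(AC|\overline B)=P(A|\overline B)P(C|\overline B)$, $P(A|B)>P(A|\overline B)$, and $P(C|B)>P(C|\overline B)$. Fork representability. A ternary relation $\mathfrak r\subseteq N^3$ is fork representable if there exist a probability space $(\Omega,\mathcal F,P)$ and events $A_i\in\mathcal F$ ($i\in N$; not required to be distinct) such that $\mathfrak r=\{(i,j,k)\in N^3 : (A_i,A_j,A_k)_P\}$. Forkness. A ternary relation $\mathfrak r$ on $N$ is a forkness if for all $i,j,k\in N$ (not necessarily distinct): (1) $(i,j,i)\in\mathfrak r\Rightarrow (j,i,j)\in\mathfrak r$; (2) $(i,j,i),(j,k,j)\in\mathfrak r\Rightarrow (i,k,i)\in\mathfrak r$; (3) $(i,k,j)\in\mathfrak r\Rightarrow (j,k,i)\in\mathfrak r$; (4) $(i,j,k)\in\mathfrak r\Rightarrow (i,j,j),(j,k,k),(k,i,i)\in\mathfrak r$; (5) $(i,k,j),(i,j,k)\in\mathfrak r\Rightarrow (j,k,j)\in\mathfrak r$. Regularity and quotient. For a forkness $\mathfrak r$ let $V_{\mathfrak r}=\{i\in N:(i,i,i)\in\mathfrak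 r\}$ and define the binary relation $\sim$ on $V_{\mathfrak r}$ by $i\sim j\Leftrightarrow (i,j,i)\in\mathfrak r$; this is an equivalence relation on $V_{\mathfrak r}$. The forkness $\mathfrak r$ is regular if $(i,j,k)\in\mathfrak r$, $i\sim i'$, $j\sim j'$, $k\sim k'$ imply $(i',j',k')\in\mathfrak r$. The quotient of a regular forkness $\mathfrak r$ is the ternary relation whose ground set is the set of equivalence classes of $\sim$ and which consists of all triples $(I,J,K)$ of classes such that $(i,j,k)\in\mathfrak r$ for at least one $i\in I$, at least one $j\in J$ and at least one $k\in K$. Solvability. A ternary relation $\mathfrak q$ is solvable if there are positive real numbers $x_{\{I,J\}}$, indexed by the two-element subsets $\{I,J\}$ of its ground set, such that $x_{\{I,K\}}=x_{\{I,J\}}+x_{\{J,K\}}$ for all $(I,J,K)\in\mathfrak q$ with $I,J,K$ pairwise distinct. *)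

(* Defs.v *)
From HB Require Import structures.
From mathcomp Require Import all_boot all_order all_algebra.
From mathcomp Require Import all_classical all_reals all_analysis.

Set Implicit Arguments.
Unset Strict Implicit.
Unset Printing Implicit Defensive.

Import Order.TTheory GRing.Theory Num.Theory.

Local Open Scope classical_set_scope.
Local Open Scope ring_scope.

Section ConjunctiveForks.
Context {R : realType} {d : measure_display} {T : measurableType d}.
Variable P : probability T R.

(* Only meaningful when P B != 0; division by 0 is total in R. *)
Definition cond_prob (A B : set T) : R := fine (P (A `&` B)) / fine (P B).

Definition conjunctive_fork (A B C : set T) : Prop :=
  [/\ (0 < P B < 1)%E,
      cond_prob (A `&` C) B = cond_prob A B * cond_prob C B,
      cond_prob (A `&` C) (~` B) = cond_prob A (~` B) * cond_prob C (~` B),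
      cond_prob A (~` B) < cond_prob A B
    & cond_prob C (~` B) < cond_prob C B].

End ConjunctiveForks.

Definition fork_representable (R : realType) (N : finType)
    (r : {set N * N * N}) : Prop :=
  exists (d : measure_display) (T : measurableType d) (P : probability T R)
         (A : N -> set T),
    (forall i, measurable (A i)) /\
    (forall i j k, (i, j, k) \in r <-> conjunctive_fork P (A i) (A j) (A k)).

Section Forkness.
Context {N : finType}.
Implicit Type r : {set N * N * N}.

Definition forkness r : Prop :=
  [/\ forall i j, (i, j, i) \in r -> (j, i, j) \in r,
      forall i j k, (i, j, i) \in r -> (j, k, j) \in r -> (i, k, i) \in r,
      forall i j k, (i, k, j) \in r -> (j, k, i) \in r,
      forall i j k, (i, j, k) \in r ->
        [/\ (i, j, j) \in r, (j, k, k) \in r & (k, i, i) \in r]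
    & forall i j k, (i, k, j) \in r -> (i, j, k) \in r -> (j, k, j) \in r].

Definition fork_vertices r : {set N} := [set i | (i, i, i) \in r]%SET.

Definition fork_equiv r : rel N := fun i j =>
  [&& i \in fork_vertices r, j \in fork_vertices r & (i, j, i) \in r].

Definition regular r : Prop :=
  forall i j k i' j' k', (i, j, k) \in r ->
    fork_equiv r i i' -> fork_equiv r j j' -> fork_equiv r k k' ->
    (i', j', k') \in r.

Definition fork_class r : finType :=
  {I : {set N} | I \in equivalence_partition (fork_equiv r) (fork_vertices r)}.

Definition fork_quotient r :
    {set fork_class r * fork_class r * fork_class r} :=
  [set IJK : fork_class r * fork_class r * fork_class r |
    [exists i in val IJK.1.1, exists j in val IJK.1.2, exists k in val IJK.2,
       (i, j, k) \in r]]%SET.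

End Forkness.

(* The unknowns are a function on all subsets of M; only its values on
   two-element subsets are constrained. *)
Definition solvable_relation (R : realType) (M : finType)
    (q : {set M * M * M}) : Prop :=
  exists x : {set M} -> R,
    (forall S : {set M}, #|S| = 2%N -> 0 < x S) /\
    (forall I J K : M, (I, J, K) \in q -> I != J -> J != K -> I != K ->
       x [set I; K]%SET = x [set I; J]%SET + x [set J; K]%SET).

(* Main.v *)
Require Import Defs.
From HB Require Import structures.
From mathcomp Require Import all_boot all_order all_algebra.
From mathcomp Require Import all_classical all_reals all_analysis.
From mathcomp Require Import ring lra.

(* (A, B, C) is a conjunctive fork iff B is nontrivial, both A, B and B, C are
   positively correlated, and A, C are uncorrelated both given B and given its
   complement; averaging the last two conditions gives that correlation
   coefficients multiply along B.  Hence minus the logarithm of the correlation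
   solves the additive system.  Conversely, from a solution x on the classes,
   take on {0,1}^M the density 2^-n (1 + sum_S c_S chi_S) with Walsh characters
   chi_S: c_IJ = exp (- lam x_IJ) for pairs that must be positively correlated,
   c_IJK equal to 0 or to a small positive constant according to whether I, J, K
   carry a fork, and other c_S = 0.  For lam large this is nonnegative, every
   coordinate has probability 1/2, and the fork conditions for (I, J, K) read
   c_IJ > 0, c_JK > 0, c_IK = c_IJ c_JK, c_IJK = 0; as c_IJ < 1, at most one of
   three distinct classes can be the middle of the fork. *)

Set Implicit Arguments.
Unset Strict Implicit.
Unset Printing Implicit Defensive.

Import Order.TTheory GRing.Theory Num.Theory.

Local Open Scope classical_set_scope.
Local Open Scope ring_scope.

(** * Forks as polynomial conditions on probabilities of intersections *)

Section ForkAlgebra.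
Context {R : realType} {d : measure_display} {T : measurableType d}.
Variable P : probability T R.
Implicit Types A B C D : set T.

Definition pr A : R := fine (P A).
Definition cov A B : R := pr (A `&` B) - pr A * pr B.
Definition var A : R := pr A * (1 - pr A).

Lemma prK A : measurable A -> (pr A)%:E = P A.
Proof. by move=> mA; rewrite fineK// fin_num_measure. Qed.

Lemma pr_ge0 A : 0 <= pr A.
Proof. by rewrite fine_ge0. Qed.

Lemma pr_le1 A : measurable A -> pr A <= 1.
Proof. by move=> mA; rewrite -lee_fin prK// probability_le1. Qed.

Lemma prC A : measurable A -> pr (~` A) = 1 - pr A.
Proof.
move=> mA; apply: EFin_inj; rewrite EFinB !prK//; last exact: measurableC.
by rewrite probability_setC.
Qed.

Lemma prID A B : measurable A -> measurable B ->
  pr (A `&` ~` B) = pr A - pr (A `&` B).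
Proof.
move=> mA mB; have mAB := measurableI _ _ mA mB.
have mD := measurableD mA mB.
apply: EFin_inj; rewrite EFinB -setDE !prK//.
by rewrite measureD// ltey_eq fin_num_measure.
Qed.

Lemma le_pr A B : measurable A -> measurable B -> A `<=` B -> pr A <= pr B.
Proof. by move=> mA mB AB; rewrite -lee_fin !prK// le_measure ?inE. Qed.

Lemma pr_le_l A B : measurable A -> measurable B -> pr (A `&` B) <= pr A.
Proof. by move=> mA mB; apply: le_pr => //; exact: measurableI. Qed.

Lemma pr_le_r A B : measurable A -> measurable B -> pr (A `&` B) <= pr B.
Proof. by move=> mA mB; rewrite setIC pr_le_l. Qed.

Lemma covC A B : cov A B = cov B A.
Proof. by rewrite /cov setIC mulrC. Qed.

Lemma cov0 B : cov set0 B = 0.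
Proof. by rewrite /cov set0I /pr measure0 mul0r subr0. Qed.

Lemma covv A : cov A A = var A.
Proof. by rewrite /cov /var setIid; ring. Qed.

Lemma var_gt0 A : (0 < pr A < 1) -> 0 < var A.
Proof. by move=> /andP[A0 A1]; rewrite mulr_gt0// subr_gt0. Qed.

(** Clearing the denominators [pr B] and [1 - pr B] makes the conditions polynomial, and each strict
    inequality becomes positivity of a covariance. *)
Lemma conjunctive_forkP A B C :
    measurable A -> measurable B -> measurable C ->
  conjunctive_fork P A B C <->
  [/\ 0 < pr B < 1,
      pr (A `&` B `&` C) * pr B = pr (A `&` B) * pr (B `&` C),
      (pr (A `&` C) - pr (A `&` B `&` C)) * (1 - pr B) =
        (pr A - pr (A `&` B)) * (pr C - pr (B `&` C)),
      0 < cov A B & 0 < cov B C].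
Proof.
move=> mA mB mC; have mAC := measurableI _ _ mA mC.
rewrite /conjunctive_fork /cond_prob.
rewrite -![fine (P _)]/(pr _) -prK// !lte_fin !prID// prC//.
rewrite (setIAC A C) (setIC C) /cov.
set a := pr A; set b := pr B; set c := pr C; set ab := pr (A `&` B).
set bc := pr (B `&` C); set ac := pr (A `&` C); set t := pr _.
have cp x y : 0 < b < 1 -> ((x - y) / (1 - b) < y / b) = (0 < y - x * b).
  move=> /andP[b0 b1]; have b1' : 0 < 1 - b by rewrite subr_gt0.
  rewrite ltr_pdivrMr// mulrAC ltr_pdivlMr// -subr_gt0; congr (_ < _); ring.
have ind x y z w : w != 0 :> R -> x / w = y / w * (z / w) <-> x * w = y * z.
  move=> w0; split=> h; last first.
    by apply: (mulIf w0); apply: (mulIf w0); rewrite mulfVK// h; field.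
  by have -> : x = x / w * w by [rewrite mulfVK]; rewrite h; field.
have b0 : 0 < b < 1 -> b != 0 by move=> /andP[/gt_eqF->].
have b1 : 0 < b < 1 -> 1 - b != 0.
  by move=> /andP[_]; rewrite -subr_gt0 => /gt_eqF->.
split=> -[b01]; rewrite !cp// [c * b]mulrC => e1 e2 c1 c2.
  by split=> //; [exact/(ind _ _ _ _ (b0 b01))|exact/(ind _ _ _ _ (b1 b01))].
by split=> //; [exact/(ind _ _ _ _ (b0 b01))|exact/(ind _ _ _ _ (b1 b01))].
Qed.
End ForkAlgebra.

(** * Covariances along a fork, and events equal up to a null set *)

Section ForkCovariance.
Context {R : realType} {d : measure_display} {T : measurableType d}.
Variable P : probability T R.
Implicit Types A B C D : set T.
Local Notation pr := (pr P).
Local Notation cov := (cov P).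
Local Notation var := (var P).
Local Notation fork := (conjunctive_fork P).

(** If [pr B] were 0 or 1, bounding the intersection by [pr B] or [pr A] would make the covariance
    at most 0. *)
Lemma cov_gt0_nontrivial A B : measurable A -> measurable B ->
  0 < cov A B -> 0 < pr B < 1.
Proof.
move=> mA mB c0; have := pr_le_l P mA mB; have := pr_le_r P mA mB.
have := pr_ge0 P A; have := pr_ge0 P B; have := pr_le1 P mA.
have := pr_le1 P mB; move: c0; rewrite /cov.
set a := pr A; set b := pr B; set ab := pr _ => *.
have -> : 0 < b by rewrite lt_neqAle; apply/andP; split => //; nra.
by rewrite lt_neqAle; apply/andP; split => //; nra.
Qed.

Lemma fork_sym A B C : fork A B C -> fork C B A.
Proof. by case=> *; split=> //; rewrite setIC mulrC. Qed.

(** The two independence identities, weighted by [1 - pr B] and [pr B], add up to this product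
    rule. *)
Lemma fork_cov A B C : measurable A -> measurable B -> measurable C ->
  fork A B C -> var B * cov A C = cov A B * cov B C.
Proof.
move=> mA mB mC /(conjunctive_forkP P mA mB mC)[_ e1 e2 _ _].
move: (congr1 ( *%R (1 - pr B)) e1) (congr1 ( *%R (pr B)) e2).
by rewrite /cov /var; lra.
Qed.

(** Both independence identities are trivial here, so triples [(i, j, j)] record positive
    correlation. *)
Lemma fork_pair A B : measurable A -> measurable B ->
  fork A B B <-> 0 < cov A B.
Proof.
move=> mA mB; rewrite (conjunctive_forkP P mA mB mB); split=> [[]//|c0].
have b01 := cov_gt0_nontrivial mA mB c0.
rewrite covv var_gt0// -setIA setIid; split=> //; ring.
Qed.

(* A and B differ by a null set. *)
Definition ae_eq_event A B : Prop := pr A = pr (A `&` B) /\ pr B = pr (A `&` B).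

Lemma ae_eq_event_sym A B : ae_eq_event A B -> ae_eq_event B A.
Proof. by case=> e1 e2; split; rewrite setIC. Qed.

Lemma ae_eq_pr A B C : measurable A -> measurable B -> measurable C ->
  ae_eq_event A B -> pr (A `&` C) = pr (B `&` C).
Proof.
move=> mA mB mC.
suff h X Y : measurable X -> measurable Y -> ae_eq_event X Y ->
    pr (X `&` C) <= pr (Y `&` C).
  by move=> AB; apply/eqP; rewrite eq_le !h//; exact: ae_eq_event_sym.
move=> mX mY [XY _]; have mXC := measurableI _ _ mX mC.
have : pr (X `&` C `&` ~` Y) <= pr (X `&` ~` Y).
  apply: le_pr => [||x [[]]//]; apply: measurableI => //; exact: measurableC.
rewrite !prID// -XY subrr subr_le0 => /le_trans; apply.
rewrite -setIA (setIC C) setIA -setIA.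
by apply: pr_le_r => //; exact: measurableI.
Qed.

Lemma ae_eq_pr1 A B : ae_eq_event A B -> pr A = pr B.
Proof. by case=> -> ->. Qed.

Lemma ae_eq_event_trans A B C : measurable A -> measurable B -> measurable C ->
  ae_eq_event A B -> ae_eq_event B C -> ae_eq_event A C.
Proof.
move=> mA mB mC AB [b c]; rewrite /ae_eq_event (ae_eq_pr mA mB mC AB).
by rewrite (ae_eq_pr1 AB).
Qed.

(** Conditional independence of [A] from itself makes [A] almost surely constant on [B] and on its
    complement; positive correlation then leaves only [B]. *)
Lemma fork_self A B : measurable A -> measurable B ->
  fork A B A <-> 0 < pr B < 1 /\ ae_eq_event A B.
Proof.
move=> mA mB; rewrite (conjunctive_forkP P mA mB mA) setIAC setIid (setIC B).
rewrite (covC P B) /ae_eq_event; have := pr_ge0 P A; have := pr_le1 P mA.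
rewrite /cov; set a := pr A; set b := pr B; set ab := pr _ => a1 a0.
split=> [[b01 e1 e2 c0 _]|[b01 [<- <-]]]; last first.
  by move: (b01) => /andP[? ?]; split=> //; nra.
split=> //; move/andP: (b01) => [b0 b1].
have ab0 : 0 < ab by nra.
have e3 : b = ab by apply: (mulfI (lt0r_neq0 ab0)).
split=> //; have /eqP : (a - ab) * (1 - b - (a - ab)) = 0 by lra.
(* With [e3], vanishing of the second factor would give [a = 1] and so zero covariance. *)
rewrite mulf_eq0 => /orP[/eqP|/eqP]; nra.
Qed.

Lemma fork_ae_eq A B C A' B' C' :
    measurable A -> measurable B -> measurable C ->
    measurable A' -> measurable B' -> measurable C' ->
    ae_eq_event A A' -> ae_eq_event B B' -> ae_eq_event C C' ->
  fork A B C -> fork A' B' C'.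
Proof.
move=> mA mB mC mA' mB' mC' AA BB CC.
have eqI X Y X' Y' : measurable X -> measurable Y -> measurable X' ->
    measurable Y' -> ae_eq_event X X' -> ae_eq_event Y Y' ->
    pr (X `&` Y) = pr (X' `&` Y').
  move=> mX mY mX' mY' XX YY.
  by rewrite (ae_eq_pr mX mX')// setIC (ae_eq_pr mY mY')// setIC.
have e3 : pr (A `&` B `&` C) = pr (A' `&` B' `&` C').
  rewrite -setIA (ae_eq_pr mA mA')//; last exact: measurableI.
  rewrite setICA (ae_eq_pr mB mB')//; last exact: measurableI.
  rewrite [X in pr X](_ : _ = C `&` (A' `&` B')); last first.
    by rewrite setIA setIC (setIC A').
  by rewrite (ae_eq_pr mC mC')//; [rewrite setIC|exact: measurableI].
move/(conjunctive_forkP P mA mB mC) => h; apply/conjunctive_forkP => //.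
move: h; rewrite /cov e3 (eqI A B A' B')// (eqI B C B' C')// (eqI A C A' C')//.
by rewrite !(ae_eq_pr1 AA, ae_eq_pr1 BB, ae_eq_pr1 CC).
Qed.

(* Cov (A, B) is at most P A (1 - P B) and at most P B (1 - P A). *)
Lemma cov_lt_var A B : measurable A -> measurable B ->
  0 < cov A B -> ~ ae_eq_event A B -> cov A B ^+ 2 < var A * var B.
Proof.
move=> mA mB c0 nAB.
have /andP[b0 b1] := cov_gt0_nontrivial mA mB c0.
have /andP[a0 a1] : 0 < pr A < 1.
  by apply: (cov_gt0_nontrivial mB mA); rewrite covC.
have hA := pr_le_l P mA mB; have hB := pr_le_r P mA mB.
rewrite ltNge; apply/negP => h; apply: nAB; rewrite /ae_eq_event.
move: c0 h hA hB a0 a1 b0 b1; rewrite /cov /var.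
set a := pr A; set b := pr B; set ab := pr _ => c0 h hA hB a0 a1 b0 b1.
set u := ab - a * b in c0 h; pose v := a * (1 - b); pose w := b * (1 - a).
have uv : u <= v by rewrite /u /v; lra.
have uw : u <= w by rewrite /u /w; lra.
(* [v * w] is [var A * var B]; as [0 < u], [u <= v] and [u <= w], this bound forces [u = v = w],
   that is [a = ab = b]. *)
have vw : v * w <= u * u by rewrite /v /w; nra.
have : u = v by nra.
have : u = w by nra.
by rewrite /u /v /w; lra.
Qed.
End ForkCovariance.

(** * Equivalence classes of a forkness and its quotient *)

Section QuotientTheory.
Context {N : finType}.
Variable r : {set N * N * N}.
Hypothesis fr : forkness r.

(** The fourth axiom is used twice: first for triples such as [(i, j, j)], then from these for the
    diagonal ones. *)
Lemma forkness_vertex i j k : (i, j, k) \in r ->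
  [/\ (i, i, i) \in r, (j, j, j) \in r & (k, k, k) \in r].
Proof.
case: fr => _ _ _ f4 _ /f4[/f4[_ jj jii] /f4[_ kk _] /f4[_ ii _]].
by split.
Qed.

Lemma fork_equivE i j : fork_equiv r i j = ((i, j, i) \in r).
Proof.
rewrite /fork_equiv; case: (boolP ((i, j, i) \in r)); rewrite ?andbF// !inE.
by case/forkness_vertex => -> -> _.
Qed.

Lemma fork_equiv_equivalence :
  {in fork_vertices r & &, equivalence_rel (fork_equiv r)}.
Proof.
case: fr => f1 f2 _ _ _ i j k; rewrite !inE => vi vj vk.
rewrite !fork_equivE; split=> // ij; apply/idP/idP => [ik|jk].
  exact: f2 (f1 _ _ ij) ik.
exact: f2 ij jk.
Qed.

Lemma fork_class_vertex (I : fork_class r) i :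
  i \in val I -> i \in fork_vertices r.
Proof.
have /andP[/eqP covr _] := equivalence_partitionP fork_equiv_equivalence.
move=> iI; rewrite -[fork_vertices r]covr; apply/bigcupP; exists (val I) => //.
exact: (valP I).
Qed.

Lemma fork_class_exists i :
  i \in fork_vertices r -> exists I : fork_class r, i \in val I.
Proof.
have /andP[/eqP covr _] := equivalence_partitionP fork_equiv_equivalence.
rewrite -{1}covr => /bigcupP[I IP iI].
by exists (exist (fun I => I \in equivalence_partition _ _) I IP).
Qed.

Lemma fork_class_nonempty (I : fork_class r) : exists i, i \in val I.
Proof.
have /and3P[_ _ n0] := equivalence_partitionP fork_equiv_equivalence.
by apply/set0Pn; apply: contraNneq n0 => <-; exact: (valP I).
Qed.

Lemma fork_class_eq (I J : fork_class r) i j : i \in val I -> j \in val J ->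
  (I == J) = ((i, j, i) \in r).
Proof.
move=> iI jJ; have vi := fork_class_vertex iI; have vj := fork_class_vertex jJ.
have /and3P[_ tP _] := equivalence_partitionP fork_equiv_equivalence.
rewrite -fork_equivE -(pblock_equivalence_partition fork_equiv_equivalence)//.
rewrite (def_pblock tP (valP I) iI); apply/eqP/idP => [->//|jI].
by apply: val_inj; rewrite -(def_pblock tP (valP I) jI)
  (def_pblock tP (valP J)).
Qed.

(** Regularity makes membership independent of the representatives. *)
Lemma fork_quotientE (I J K : fork_class r) i j k : regular r ->
  i \in val I -> j \in val J -> k \in val K ->
  ((I, J, K) \in fork_quotient r) = ((i, j, k) \in r).
Proof.
move=> rr iI jJ kK; rewrite inE /=; apply/idP/idP => [|ijk].
  case/exists_inP => i' iI' /exists_inP[j' jJ' /exists_inP[k' kK' h]].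
  by apply: rr h _ _ _; rewrite fork_equivE -?(fork_class_eq iI' iI)
    -?(fork_class_eq jJ' jJ) -?(fork_class_eq kK' kK) eqxx.
apply/exists_inP; exists i => //; apply/exists_inP; exists j => //.
by apply/exists_inP; exists k.
Qed.
End QuotientTheory.

(** The double sum turns a function of ordered pairs into a function of sets, as the unknowns of the
    additive system must be. *)
Lemma sum_offdiag_set2 (R : nmodType) (M : finType) (f : M -> M -> R)
    (I J : M) : I != J ->
  \sum_(K in [set I; J]%SET) \sum_(L in [set I; J]%SET | L != K) f K L =
    f I J + f J I.
Proof.
move=> IJ; rewrite finset.big_setU1 ?inE//= big_set1.
congr (_ + _); apply: big_pred1 => K; rewrite !inE.
  by have [->|/=] := eqVneq K I; rewrite ?andbT//= (negbTE IJ).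
by have [->|/=] := eqVneq K J; rewrite ?andbT ?orbF// andbF eq_sym (negbTE IJ).
Qed.

(** * Necessity: axioms, regularity and solvability from a representation *)

Section Necessity.
Context {R : realType} {d : measure_display} {T : measurableType d}.
Variables (P : probability T R) (N : finType) (r : {set N * N * N}).
Variable A : N -> set T.
Hypothesis mA : forall i, measurable (A i).
Hypothesis Ar : forall i j k,
  (i, j, k) \in r <-> conjunctive_fork P (A i) (A j) (A k).
Local Notation cov i j := (cov P (A i) (A j)).
Local Notation var i := (var P (A i)).

Lemma fork_cov_gt0 i j k : (i, j, k) \in r ->
  [/\ 0 < var j, 0 < cov i j, 0 < cov j k & 0 < cov i k].
Proof.
move=> /Ar h; have := fork_cov (mA i) (mA j) (mA k) h.
case/(conjunctive_forkP P (mA i) (mA j) (mA k)): h => /var_gt0 v _ _ ij jk e.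
by split=> //; rewrite -(pmulr_rgt0 _ v) e mulr_gt0.
Qed.

Lemma mem_fork_pair i j : 0 < cov i j -> (i, j, j) \in r.
Proof. by move=> c0; apply/Ar/fork_pair. Qed.

Lemma mem_fork_self i j : (i, j, i) \in r <->
  0 < pr P (A j) < 1 /\ ae_eq_event P (A i) (A j).
Proof. by rewrite Ar fork_self. Qed.

Lemma representable_forkness : forkness r.
Proof.
split.
- move=> i j /mem_fork_self[vj ij]; apply/mem_fork_self.
  by split; [rewrite (ae_eq_pr1 ij)|exact: ae_eq_event_sym].
- move=> i j k /mem_fork_self[_ ij] /mem_fork_self[vk jk]; apply/mem_fork_self.
  by split => //; exact: ae_eq_event_trans jk.
- by move=> i j k /Ar/fork_sym h; exact/Ar.
- move=> i j k /fork_cov_gt0[_ ij jk ik].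
  by split; apply: mem_fork_pair; rewrite // covC.
(* Fifth axiom: the product of the two fork identities gives [cov j k ^+ 2 = var j * var k], which
   [cov_lt_var] excludes unless the events agree up to a null set. *)
move=> i j k ikj ijk; apply/mem_fork_self.
have [_ ik kj ij] := fork_cov_gt0 ikj.
split; first exact: cov_gt0_nontrivial ik.
have /Ar/(fork_cov (mA i) (mA k) (mA j)) e1 := ikj.
have /Ar/(fork_cov (mA i) (mA j) (mA k)) e2 := ijk.
apply: contrapT => /(cov_lt_var (mA j) (mA k)).
rewrite covC => /(_ kj); rewrite ltNge => /negP; apply.
move: e1 e2; rewrite (covC P (A j)) => e1 e2.
have c0 : 0 < cov i j * cov i k by rewrite mulr_gt0.
rewrite -(ler_pM2l c0) le_eqVlt; apply/orP; left; apply/eqP.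
have -> : cov i j * cov i k * (var j * var k) =
  (var k * cov i j) * (var j * cov i k) by ring.
by rewrite e1 e2; ring.
Qed.

Lemma representable_regular : regular r.
Proof.
move=> i j k i' j' k' /Ar h /and3P[_ _ /mem_fork_self[_ ii]].
move=> /and3P[_ _ /mem_fork_self[_ jj]] /and3P[_ _ /mem_fork_self[_ kk]].
by apply/Ar; move: h; exact: fork_ae_eq.
Qed.

(* Minus twice the logarithm of the correlation coefficient, when positive. *)
Definition log_corr i j : R :=
  if 0 < cov i j then ln (var i * var j / cov i j ^+ 2) else 1.

Lemma log_corrC i j : log_corr i j = log_corr j i.
Proof. by rewrite /log_corr covC (mulrC (var i)). Qed.

(** The default value [1] settles pairs without positive covariance; the others are not equal up to
    a null set, so [cov_lt_var] is strict. *)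
Lemma log_corr_gt0 i j : (i, j, i) \notin r -> 0 < log_corr i j.
Proof.
move=> nij; rewrite /log_corr; case: ifPn => // ij.
apply: ln_gt0; rewrite ltr_pdivlMr ?exprn_gt0// mul1r cov_lt_var//.
move=> h; move/negP: nij; apply; apply/mem_fork_self; split=> //.
exact: cov_gt0_nontrivial ij.
Qed.

(** All three covariances are positive, so every value is a logarithm, and [fork_cov] makes the
    squared correlations multiply. *)
Lemma log_corr_additive i j k : (i, j, k) \in r ->
  log_corr i k = log_corr i j + log_corr j k.
Proof.
move=> ijk; have [vj ij jk ik] := fork_cov_gt0 ijk.
have v m n : 0 < cov m n -> 0 < var m /\ 0 < var n.
  move=> mn; split; apply/var_gt0; first rewrite covC in mn.
    exact: cov_gt0_nontrivial mn.
  exact: cov_gt0_nontrivial mn.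
have [vi vk] := v _ _ ik.
have pos m n : 0 < cov m n -> var m * var n / cov m n ^+ 2 \is Num.pos.
  move=> mn; have [vm vn] := v _ _ mn.
  by rewrite posrE divr_gt0 ?exprn_gt0//; exact: mulr_gt0.
rewrite /log_corr ij jk ik -lnM ?pos//.
have /Ar/(fork_cov (mA i) (mA j) (mA k)) e := ijk.
have -> : cov i k = cov i j * cov j k / var j.
  by rewrite -e mulrAC divff ?mul1r// gt_eqF.
by congr ln; field; rewrite !gt_eqF.
Qed.

Lemma representable_solvable : solvable_relation R (fork_quotient r).
Proof.
have fr := representable_forkness.
have [rep repP] := choice (fork_class_nonempty fr).
(* On two classes this is twice the symmetric [log_corr] of their representatives. *)
exists (fun S : {set fork_class r} =>
  \sum_(I in S) \sum_(J in S | J != I) log_corr (rep I) (rep J)).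
split=> [S /eqP/cards2P[I [J [IJ ->]]]|I J K IJK IJ JK IK].
  rewrite sum_offdiag_set2//.
  by rewrite addr_gt0// log_corr_gt0//
    -(fork_class_eq fr (repP _) (repP _))// eq_sym.
move: IJK; rewrite (fork_quotientE fr representable_regular
  (repP I) (repP J) (repP K)) => /log_corr_additive e.
rewrite !sum_offdiag_set2// !(log_corrC (rep K)) (log_corrC (rep J) (rep I)) e.
by ring.
Qed.
End Necessity.

(** * Finite probability spaces carried by the natural numbers *)

Section FiniteProbability.
Context {R : realType} {Omega : finType} (w0 : Omega) (p : Omega -> R).
Hypothesis p_ge0 : forall w, 0 <= p w.
Hypothesis p_sum1 : \sum_w p w = 1.

Definition decode (n : nat) : Omega := nth w0 (enum Omega) n.

(** Each [k < #|Omega|] carries the mass of the [k]-th element of [Omega]; larger numbers, which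
    [decode] sends to [w0], have mass 0. *)
Definition finite_prob : set nat -> \bar R :=
  msum (fun k => mscale (NngNum (p_ge0 (decode k))) \d_k) #|Omega|.

HB.instance Definition _ := Measure.on finite_prob.

Lemma finite_probE (D : pred Omega) :
  finite_prob [set n | D (decode n)] = (\sum_(w | D w) p w)%:E.
Proof.
transitivity (\sum_(k < #|Omega|) (p (decode k) * (D (decode k))%:R)%:E)%E.
  apply: eq_bigr => k _; rewrite EFinM; congr (_ * _)%E.
  rewrite /= /dirac indicE; congr ((nat_of_bool _)%:R%:E).
  by have [Dk|/negP Dk] := boolP (D (decode k)); [exact: mem_set|exact: memNset].
rewrite sumEFin; congr _%:E.
rewrite [RHS]big_mkcond -[RHS]big_enum /= (big_nth w0) -cardE big_mkord.
by apply: eq_bigr => k _; rewrite -/(decode k); case: (D _);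
  rewrite (mulr1, mulr0).
Qed.

Let finite_probT : finite_prob setT = 1%:E.
Proof.
rewrite -p_sum1 -(finite_probE xpredT); congr (finite_prob _).
by apply/seteqP; split.
Qed.

HB.instance Definition _ :=
  Measure_isProbability.Build _ _ _ finite_prob finite_probT.

Lemma finite_probability : exists (P : probability nat R) (X : nat -> Omega),
  forall D : pred Omega, P [set n | D (X n)] = (\sum_(w | D w) p w)%:E.
Proof. by exists finite_prob, decode; exact: finite_probE. Qed.
End FiniteProbability.

(** * Walsh densities on the subsets of a finite set, and their moments *)

Section WalshDensity.
Variables (R : realFieldType) (M : finType) (c : {set M} -> R).

(** The character of [S] is a product of signs over [S], [1] in [w] and [-1] outside. A sign at a
    point outside [U] is free and averages to zero; those in [U] all equal [1]. *)
Lemma sum_walsh (S U : {set M}) :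
  \sum_(w : {set M} | U \subset w) 2^-1 ^+ #|M| * (-1) ^+ #|S :\: w| =
    (S \subset U)%:R * 2^-1 ^+ #|U| :> R.
Proof.
(* The product of the factors (2^-1 + G i), expanded, is the left-hand side. *)
pose G i : R := if i \in U then 0 else if i \in S then - 2^-1 else 2^-1.
have -> : (S \subset U)%:R * 2^-1 ^+ #|U| = \prod_i (2^-1 + G i).
  case: (boolP (S \subset U)) => [/fintype.subsetP SU|/subsetPn[i iS iU]].
    rewrite mul1r -prodr_const big_mkcond; apply: eq_bigr => i _; rewrite /G.
    case: ifPn => iU; first by rewrite addr0.
    by rewrite ifN; [field|apply: contra iU; exact: SU].
  by rewrite mul0r (bigD1 i)//= /G (negbTE iU) iS subrr mul0r.
rewrite bigA_distr big_mkcond /=; apply: eq_bigr => w _.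
case: ifPn => [/fintype.subsetP Uw|/subsetPn[i iU iw]]; last first.
  by rewrite (bigD1 i)//= (negbTE iw) /G iU mul0r.
rewrite -!prodr_const [X in _ * X]big_mkcond -big_split /=.
apply: eq_bigr => i _; rewrite !inE /G.
case: (boolP (i \in w)) => iw /=; first by rewrite mulr1.
rewrite (_ : i \in U = false); last by apply: contraNF iw; exact: Uw.
by case: (i \in S); rewrite ?mulrN1 ?mulr1.
Qed.

Definition walsh_density (w : {set M}) : R :=
  \sum_(S : {set M}) c S * (2^-1 ^+ #|M| * (-1) ^+ #|S :\: w|).

Lemma sum_walsh_density (U : {set M}) :
  \sum_(w : {set M} | U \subset w) walsh_density w =
    2^-1 ^+ #|U| * \sum_(S in powerset U) c S.
Proof.
rewrite exchange_big /= mulr_sumr [RHS]big_mkcond /=; apply: eq_bigr => S _.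
rewrite -mulr_sumr sum_walsh powersetE; case: (S \subset U).
  by rewrite mul1r mulrC.
by rewrite mul0r mulr0.
Qed.

(** With [n = #|M|], the [2^n - 1] nonempty sets contribute at most [2^-n] each in absolute value,
    against the constant term [1]. *)
Lemma walsh_density_ge0 (w : {set M}) : c finset.set0 = 1 ->
    (forall S, S != finset.set0 -> `|c S| <= 2^-1 ^+ #|M|) ->
  0 <= walsh_density w.
Proof.
move=> c0 cS; rewrite /walsh_density.
under eq_bigr => S _ do rewrite mulrCA; rewrite -mulr_sumr.
rewrite mulr_ge0 ?exprn_ge0 ?invr_ge0//.
rewrite (bigD1 finset.set0)//= c0 finset.set0D cards0 expr0 mulr1.
rewrite -lerBlDl sub0r.
set s := \sum_(S | _) _.
have : `|s| <= \sum_(S : {set M} | S != finset.set0) 2^-1 ^+ #|M|.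
  apply: (le_trans (ler_norm_sum _ _ _)); apply: ler_sum => S S0.
  by rewrite normrM normrX normrN1 expr1n mulr1 cS.
rewrite ler_norml => /andP[+ _]; apply: le_trans; rewrite lerN2.
have e : 1 = \sum_(S : {set M}) 2^-1 ^+ #|M| :> R.
  rewrite sumr_const -[X in _ *+ X]cardsT -powersetT card_powerset cardsT.
  by rewrite -[RHS]mulr_natl natrX -exprMn divff ?expr1n// pnatr_eq0.
by rewrite [leRHS]e [leRHS](bigD1 finset.set0)//= lerDr exprn_ge0 ?invr_ge0.
Qed.

Lemma sum_powersetU1 (U : {set M}) i : i \notin U ->
  \sum_(S in powerset (i |: U)) c S =
    \sum_(S in powerset U) c S + \sum_(S in powerset U) c (i |: S)%SET.
Proof.
move=> iU; rewrite (bigID (fun S : {set M} => i \in S)) /= addrC; congr (_ + _).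
  apply: eq_bigl => S; rewrite !powersetE.
  apply/andP/idP => [[/fintype.subsetP SiU iS]|/fintype.subsetP SU].
    apply/fintype.subsetP => j jS; have := SiU j jS.
    by rewrite !inE => /orP[/eqP ji|//]; rewrite -ji jS in iS.
  split; first by apply/fintype.subsetP => j /SU jU; rewrite !inE jU orbT.
  by apply: contra iU; exact: SU.
rewrite (reindex_onto (fun S => i |: S)%SET (fun S => S :\ i)%SET) /=.
  apply: eq_bigl => S; rewrite !powersetE setU11 andbT.
  apply/andP/idP => [[/fintype.subsetP SiU /eqP iS]|SU].
    apply/fintype.subsetP => j; rewrite -iS !inE => /andP[ji /orP[|jS]].
      by rewrite (negbTE ji).
    by have := SiU j; rewrite !inE jS orbT (negbTE ji) => /(_ isT).
  split; first exact: finset.setUS.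
  apply/eqP/finset.setU1K; apply: contra iU; exact: (fintype.subsetP SU).
by move=> S /andP[_ iS]; rewrite finset.setD1K.
Qed.
End WalshDensity.

(** [A I] is the event that the random subset of [M] contains [I]; [sum_walsh_density] is read for
    [U] of size 1, 2 and 3. *)
Lemma walsh_probability (R : realType) (M : finType) (c : {set M} -> R) :
    c finset.set0 = 1 -> (forall I, c [set I]%SET = 0) ->
    (forall S, S != finset.set0 -> `|c S| <= 2^-1 ^+ #|M|) ->
  exists (P : probability nat R) (A : M -> set nat),
    [/\ forall I, pr P (A I) = 1 / 2,
        forall I J, I != J -> pr P (A I `&` A J) = (1 + c [set I; J]%SET) / 4
      & forall I J K, I != J -> J != K -> I != K ->
        pr P (A I `&` A J `&` A K) =
          (1 + c [set I; J]%SET + c [set J; K]%SET + c [set I; K]%SET +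
             c [set I; J; K]%SET) / 8].
Proof.
move=> c0 c1 cS.
have density1 : \sum_w walsh_density c w = 1.
  have := sum_walsh_density c finset.set0; rewrite powerset0 big_set1 c0 cards0.
  by rewrite expr0 mulr1 => <-; apply: eq_bigl => w; rewrite finset.sub0set.
have [P [X PX]] := finite_probability finset.set0
  (fun w => walsh_density_ge0 w c0 cS) density1.
have prX (U : {set M}) : pr P [set n | U \subset X n] =
    2^-1 ^+ #|U| * \sum_(S in powerset U) c S.
  by rewrite /pr (PX (fun w => U \subset w)) /= sum_walsh_density.
have sum1 (f : {set M} -> R) I :
    \sum_(S in powerset [set I]%SET) f S = f finset.set0 + f [set I]%SET.
  rewrite -{1}(finset.setU0 [set I]%SET) sum_powersetU1 ?inE//.
  by rewrite powerset0 !big_set1 finset.setU0.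
have sum2 (f : {set M} -> R) I J : I != J ->
    \sum_(S in powerset [set I; J]%SET) f S =
      f finset.set0 + f [set I]%SET + f [set J]%SET + f [set I; J]%SET.
  move=> IJ; rewrite sum_powersetU1 ?inE// !sum1 finset.setU0.
  by rewrite [_ + f [set I]%SET + _]addrAC !addrA.
exists P, (fun I => [set n | I \in X n]); split=> [I|I J IJ|I J K IJ JK IK].
- transitivity (pr P [set n | [set I]%SET \subset X n]).
    by congr (pr P _); apply/seteqP; split=> n /=; rewrite finset.sub1set.
  by rewrite prX cards1 sum1 c0 c1; field.
- transitivity (pr P [set n | [set I; J]%SET \subset X n]).
    congr (pr P _); apply/seteqP; split=> n /=;
      rewrite finset.subUset !finset.sub1set.
      by move=> [-> ->].
    by move/andP.
  by rewrite prX cards2 IJ sum2// c0 !c1 /=; field.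
transitivity (pr P [set n | [set I; J; K]%SET \subset X n]).
  congr (pr P _); apply/seteqP; split=> n /=.
    by rewrite !finset.subUset !finset.sub1set => -[[-> ->] ->].
  by rewrite !finset.subUset !finset.sub1set => /andP[/andP[]].
have -> : [set I; J; K]%SET = (I |: [set J; K])%SET by rewrite finset.setUA.
rewrite prX cardsU1 cards2 JK !inE (negbTE IJ) (negbTE IK) /=.
rewrite sum_powersetU1 ?inE ?negb_or ?IJ// !sum2// c0 finset.setU0 !c1.
by field.
Qed.

(** The cases are grouped by the middle entry, since forks are symmetric in the outer two. *)
Lemma set3_eq_cases (M : finType) (I J K I' J' K' : M) :
    I != J -> J != K -> I != K -> [set I'; J'; K']%SET = [set I; J; K]%SET ->
  [\/ J' = J /\ (I' = I /\ K' = K \/ I' = K /\ K' = I),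
      J' = I /\ (I' = J /\ K' = K \/ I' = K /\ K' = J)
    | J' = K /\ (I' = I /\ K' = J \/ I' = J /\ K' = I)].
Proof.
move=> IJ JK IK e.
have mem x : x \in [set I; J; K]%SET -> [|| x == I', x == J' | x == K'].
  by rewrite -e !inE orbA.
have := (mem I, mem J, mem K); rewrite !inE !eqxx !orbT => -[[]].
move=> /(_ isT)/or3P[]/eqP eI /(_ isT)/or3P[]/eqP eJ /(_ isT)/or3P[]/eqP eK;
  subst; rewrite ?eqxx in IJ JK IK => //;
  by [constructor 1; tauto|constructor 2; tauto|constructor 3; tauto].
Qed.

(** The right side is [conjunctive_forkP] at the moments of [walsh_probability]; its two identities
    reduce to [e + t = a * b] and [e - t = a * b]. *)
Lemma fork_moments (R : realFieldType) (a b e t : R) :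
  [/\ 0 < a, 0 < b, e = a * b & t = 0] <->
  [/\ 0 < (1 / 2 : R) < 1,
      (1 + a + b + e + t) / 8 * (1 / 2) = (1 + a) / 4 * ((1 + b) / 4),
      ((1 + e) / 4 - (1 + a + b + e + t) / 8) * (1 - 1 / 2) =
        (1 / 2 - (1 + a) / 4) * (1 / 2 - (1 + b) / 4),
      0 < a & 0 < b].
Proof.
split=> [[a0 b0 -> ->]|[_ e1 e2 a0 b0]]; last by split=> //; lra.
by split=> //; [lra|field|field].
Qed.

(** Two different middles of one triple would produce this equation, which forces [a ^+ 2 = 1]. *)
Lemma eq_mul_lt1 (R : realFieldType) (a b : R) :
  0 < a -> 0 < b -> a < 1 -> b <> a * (a * b).
Proof.
move=> a0 b0 a1; apply/eqP; rewrite gt_eqF// mulrA gtr_pMl//.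
by rewrite mulr_ilt1 // ltW.
Qed.

(** The existentials range over all orderings of [S], so a triple gets 0 as soon as one ordering
    lies in [q]. The other triples get the largest value that [walsh_density_ge0] allows. *)
Definition walsh_coef (R : realType) (M : finType) (q : {set M * M * M})
    (lam : R) (x : {set M} -> R) (S : {set M}) : R :=
  if S == finset.set0 then 1
  else if (#|S| == 2)%N && [exists I, exists J,
      (S == [set I; J]%SET) && ((I, J, J) \in q)] then expR (- (lam * x S))
  else if (#|S| == 3)%N && ~~ [exists I, exists J, exists K,
      (S == [set I; J; K]%SET) && ((I, J, K) \in q)] then 2^-1 ^+ #|M|
  else 0.

(** * Sufficiency for a forkness whose equivalence is equality on the whole ground set *)

Section Sufficiency.
Variables (R : realType) (M : finType) (q : {set M * M * M}).
Hypothesis fq : forkness q.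
Hypothesis q_refl : forall I, (I, I, I) \in q.
Hypothesis q_anti : forall I J, (I, J, I) \in q -> I = J.

Lemma forkness_pair_sym I J : (I, J, J) \in q -> (J, I, I) \in q.
Proof. by case: fq => _ _ _ f4 _ /f4[]. Qed.

Section Coef.
Variables (lam : R) (x : {set M} -> R).
Hypothesis x_add : forall I J K : M,
  (I, J, K) \in q -> I != J -> J != K -> I != K ->
  x [set I; K]%SET = x [set I; J]%SET + x [set J; K]%SET.
Hypothesis lam_large : forall S : {set M}, #|S| = 2%N -> 2 ^+ #|M| <= lam * x S.
Local Notation c := (walsh_coef q lam x).

Lemma walsh_coef0 : c finset.set0 = 1.
Proof. by rewrite /walsh_coef eqxx. Qed.

Lemma walsh_coef1 I : c [set I]%SET = 0.
Proof. by rewrite /walsh_coef -cards_eq0 cards1. Qed.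

Lemma walsh_coef2 I J : I != J ->
  c [set I; J]%SET =
    if (I, J, J) \in q then expR (- (lam * x [set I; J]%SET)) else 0.
Proof.
move=> IJ; rewrite /walsh_coef -cards_eq0 cards2 IJ /=.
congr (if _ then _ else _).
apply/existsP/idP => [[I' /existsP[J' /andP[/eqP e qIJ]]]|qIJ]; last first.
  by exists I; apply/existsP; exists J; rewrite eqxx.
have := set21 I J; have := set22 I J; rewrite e !inE.
move=> /orP[]/eqP eJ /orP[]/eqP eI; move: IJ qIJ;
  rewrite eI eJ ?eqxx// => _ //; exact: forkness_pair_sym.
Qed.

Lemma walsh_coef3 I J K : I != J -> J != K -> I != K ->
  c [set I; J; K]%SET =
    if [exists I', exists J', exists K',
      ([set I; J; K]%SET == [set I'; J'; K']%SET) && ((I', J', K') \in q)]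
    then 0 else 2^-1 ^+ #|M|.
Proof.
move=> IJ JK IK; rewrite /walsh_coef -cards_eq0.
have -> : #|[set I; J; K]%SET| = 3%N.
  by rewrite finset.setUC cardsU1 cards2 IJ !inE negb_or eq_sym IK eq_sym JK.
by rewrite /=; case: ifP => [/negbTE->|/negbFE->].
Qed.

(** For pairs, [expR y >= 1 + y] is applied at [y = lam * x S], which [lam_large] bounds below. *)
Lemma walsh_coef_le S : S != finset.set0 -> `|c S| <= 2^-1 ^+ #|M|.
Proof.
move=> S0; rewrite /walsh_coef (negbTE S0); case: ifPn => [/andP[/eqP S2 _]|_].
  rewrite ger0_norm ?expR_ge0// expRN exprVn lef_pV2 ?posrE ?expR_gt0
    ?exprn_gt0//.
  apply: le_trans (lam_large S2) _; apply: le_trans (expR_ge1Dx _).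
  by rewrite lerDr.
by case: ifPn => _; rewrite ?normr0 ?ger0_norm ?exprn_ge0 ?invr_ge0.
Qed.

Lemma walsh_coef2_lt1 I J : I != J -> c [set I; J]%SET < 1.
Proof.
move=> IJ; rewrite walsh_coef2//; case: ifP => _ //.
rewrite expR_lt1 oppr_lt0; apply: lt_le_trans (lam_large _).
  by rewrite exprn_gt0.
by rewrite cards2 IJ.
Qed.

Lemma walsh_coef2_gt0 I J : I != J ->
  (0 < c [set I; J]%SET) = ((I, J, J) \in q).
Proof.
by move=> IJ; rewrite walsh_coef2//; case: ifP; rewrite ?expR_gt0 ?ltxx.
Qed.

Lemma walsh_coef_mul I J K : I != J -> J != K -> I != K -> (I, J, K) \in q ->
  c [set I; K]%SET = c [set I; J]%SET * c [set J; K]%SET.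
Proof.
move=> IJ JK IK qIJK; case: fq => _ _ _ f4 _.
have [qIJ qJK /forkness_pair_sym qIK] := f4 _ _ _ qIJK.
by rewrite !walsh_coef2// qIJ qJK qIK (x_add qIJK)// -expRD; congr expR; ring.
Qed.

(** For the converse, a zero triple coefficient says that some ordering lies in [q]. A middle other
    than [J] would give a second product rule, contradicting the assumed one by [eq_mul_lt1]. *)
Lemma mem_fork_coef I J K : I != J -> J != K -> I != K ->
  (I, J, K) \in q <->
  [/\ 0 < c [set I; J]%SET, 0 < c [set J; K]%SET,
      c [set I; K]%SET = c [set I; J]%SET * c [set J; K]%SET
    & c [set I; J; K]%SET = 0].
Proof.
move=> IJ JK IK; split=> [qIJK|].
  case: (fq) => _ _ _ f4 _; have [qIJ qJK _] := f4 _ _ _ qIJK.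
  rewrite !walsh_coef2_gt0//; split=> //; first exact: walsh_coef_mul.
  rewrite walsh_coef3// ifT//; apply/existsP; exists I; apply/existsP; exists J.
  by apply/existsP; exists K; rewrite eqxx.
case=> cIJ cJK cIK; rewrite walsh_coef3//; case: ifPn => [|_ /eqP]; last first.
  by rewrite expf_eq0 invr_eq0 pnatr_eq0 andbF.
case/existsP => I' /existsP[J' /existsP[K' /andP[/eqP e qIJK]]] _.
case: (fq) => _ _ f3 _ _.
have IJ1 := walsh_coef2_lt1 IJ; have JK1 := walsh_coef2_lt1 JK.
have sym X Y : [set X; Y]%SET = [set Y; X]%SET :> {set M} by rewrite finset.setUC.
have [[EJ h]|[EJ h]|[EJ h]] := set3_eq_cases IJ JK IK (esym e); subst J'.
- by case: h qIJK => -[-> ->] // /f3.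
- have qJIK : (J, I, K) \in q by case: h qIJK => -[-> ->] // /f3.
  have := walsh_coef_mul _ IK JK qJIK; rewrite eq_sym (sym J I) => /(_ IJ).
  by rewrite cIK => /(eq_mul_lt1 cIJ cJK IJ1).
have qIKJ : (I, K, J) \in q by case: h qIJK => -[-> ->] // /f3.
have := walsh_coef_mul IK _ IJ qIKJ; rewrite eq_sym (sym K J) => /(_ JK).
by rewrite cIK -mulrA mulrC -mulrA => /(eq_mul_lt1 cJK cIJ JK1).
Qed.
End Coef.


Lemma reduced_fork_representable : solvable_relation R q ->
  exists (P : probability nat R) (A : M -> set nat),
    forall I J K, (I, J, K) \in q <-> conjunctive_fork P (A I) (A J) (A K).
Proof.
case=> x [x_gt0 x_add].
(* The sum dominates [(x S)^-1] for every pair [S], so one [lam] serves all pairs. *)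
pose lam : R := 2 ^+ #|M| * \sum_(S : {set M}) `|x S|^-1.
have lam_large (S : {set M}) : #|S| = 2%N -> 2 ^+ #|M| <= lam * x S.
  move=> S2; have xS := x_gt0 S S2.
  rewrite /lam -mulrA ler_peMr ?exprn_ge0// -ler_pdivrMr// mul1r.
  by rewrite (bigD1 S)//= gtr0_norm// lerDl sumr_ge0.
pose c := walsh_coef q lam x.
have [P [A [pr1 pr2 pr3]]] := walsh_probability
  (walsh_coef0 lam x) (walsh_coef1 lam x) (walsh_coef_le lam_large).
rewrite -/c in pr2 pr3; exists P, A => I J K.
have mA L : measurable (A L) by [].
have covA X Y : X != Y -> cov P (A X) (A Y) = c [set X; Y]%SET / 4.
  by move=> XY; rewrite /cov pr2// !pr1; field.
have pairE X Y : (X, Y, Y) \in q <-> conjunctive_fork P (A X) (A Y) (A Y).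
  rewrite fork_pair//; have [->|XY] := eqVneq X Y.
    by rewrite q_refl covv /var pr1; split=> // _; lra.
  by rewrite covA// pmulr_lgt0 ?invr_gt0// (walsh_coef2_gt0 lam x XY).
have f3 := let: And5 _ _ f3 _ _ := fq in f3.
have [->|JK] := eqVneq J K; first exact: pairE.
have [->|IJ] := eqVneq I J.
  by split=> [/f3/pairE/fork_sym//|/fork_sym/pairE/f3].
have [IK|IK] := eqVneq I K.
  subst K; split=> [/q_anti IJ'|/(fork_self P (mA I) (mA J))[_ [+ _]]].
    by rewrite IJ' eqxx in IJ.
  (* Equality up to a null set would mean [1 / 2 = (1 + c) / 4] for the pair coefficient, that is,
     coefficient 1. *)
  by rewrite pr1 pr2//; have := walsh_coef2_lt1 lam_large IJ; rewrite -/c; lra.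
rewrite (mem_fork_coef x_add lam_large IJ JK IK) -/c conjunctive_forkP// !covA//.
rewrite !pmulr_lgt0 ?invr_gt0// !pr1 pr3// !pr2//.
exact: fork_moments.
Qed.
End Sufficiency.

(** * The equivalence, its converse lifted from the quotient to the ground set *)

Theorem theorem1 (R : realType) (N : finType) (r : {set N * N * N}) :
  fork_representable R r <->
  [/\ forkness r, regular r & solvable_relation R (fork_quotient r)].
Proof.
split=> [[d [T [P [A [mA Ar]]]]]|[fr rr sr]].
  split; [exact: representable_forkness Ar|exact: representable_regular Ar|].
  exact: representable_solvable Ar.
have [rep repP] := choice (fork_class_nonempty fr).
have qE I J K : ((I, J, K) \in fork_quotient r) = ((rep I, rep J, rep K) \in r).
  exact: fork_quotientE.
have fq : forkness (fork_quotient r).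
  case: (fr) => f1 f2 f3 f4 f5; split=> I J K; rewrite !qE; eauto.
have q_refl I : (I, I, I) \in fork_quotient r.
  by have := fork_class_vertex fr (repP I); rewrite qE inE.
have q_anti I J : (I, J, I) \in fork_quotient r -> I = J.
  by rewrite qE -(fork_class_eq fr (repP I) (repP J)) => /eqP.
have [P [A AP]] := reduced_fork_representable fq q_refl q_anti sr.
have clsP i : exists o : option (fork_class r),
    if o is Some C then i \in val C else i \notin fork_vertices r.
  have [/(fork_class_exists fr)[I iI]|iV] := boolP (i \in fork_vertices r).
    by exists (Some I).
  by exists None.
have [cls clsE] := choice clsP.
(* Vertices share the event of their class. A non-vertex gets [set0], which has covariance 0 with
   every event and so occurs in no fork. *)
exists default_measure_display, nat, P,
  (fun i => if cls i is Some C then A C else set0).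
split=> // i j k; have [[ci cj] ck] := (clsE i, clsE j, clsE k).
case: (cls i) ci => [I iI|vi]; last first.
  split=> [/(forkness_vertex fr)[ii _ _]|/conjunctive_forkP[]//].
    by rewrite inE ii in vi.
  by rewrite cov0 ltxx.
case: (cls j) cj => [J jJ|vj]; last first.
  split=> [/(forkness_vertex fr)[_ jj _]|/conjunctive_forkP[]//].
    by rewrite inE jj in vj.
  by rewrite covC cov0 ltxx.
case: (cls k) ck => [K kK|vk]; last first.
  split=> [/(forkness_vertex fr)[_ _ kk]|/conjunctive_forkP[]//].
    by rewrite inE kk in vk.
  by rewrite (covC _ (A J)) cov0 ltxx.
by rewrite -AP (fork_quotientE fr rr iI jJ kK).
Qed.
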